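(* Let $\bar\rho$ be the projected joint spectral radius. Fix any $\varepsilon\in(0,1-\bar\rho)$ and define $\beta_\varepsilon:=\bar\rho+\varepsilon$. Then there exists $C_{\beta_\varepsilon}>0$ such that every sequence $(Q_k)_{k\ge0}$ generated by deflated Q-value iteration satisfies, for all $k\ge1$, \[ \|Q_k-Q^\star\|_2\le C_{\beta_\varepsilon}\,\beta_\varepsilon^{k-1}\,\|\boldsymbol{\Pi}_\perp(Q_0-Q^\star)\|_2 . \] Consequently, \[ \limsup_{k\to\infty}\|Q_k-Q^\star\|_2^{1/k}\le\bar\rho . \] In particular, if $\bar\rho<\gamma$, then this certified convergence rate is strictly smaller than $\gamma$ (the worst-case full-error rate of standard Q-value iteration $Q_{k+1}=F(Q_k)$).
   Context: Setting: a finite discounted Markov decision process with finite nonempty state space $\mathcal S$, finite nonempty action space $\mathcal A$, transition probabilities $P(s'\mid s,a)$, real rewards $r(s,a,s')$, discount factor $\gamma\in(0,1)$, and expected reward $R(s,a):=\sum_{s'}P(s'\mid s,a)r(s,a,s')$. Put $n:=|\mathcal S||\mathcal A|$; vectors in $\mathbb R^n$ are indexed by pairs $(s,a)$. The Bellman optimality operator $F:\mathbb R^n\to\mathbb R^n$ is $(FQ)(s,a):=R(s,a)+\gamma\sum_{s'}P(s'\mid s,a)\max_{a'}Q(s',a')$, and $Q^\star$ is its unique fixed point (the optimal Q-function). $\mathbf 1$ is the all-ones vector, $\operatorname{span}(\mathbf 1)^\perp=\{x\in\mathbb R^n:\mathbf 1^\top x=0\}$, and $\boldsymbol{\Pi}_\perp:=I-\frac1n\mathbf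 1\mathbf 1^\top$. Deflated Q-value iteration is, from an arbitrary $Q_0\in\mathbb R^n$, \[ Q_{k+1}=F(Q_k)+\frac{\gamma}{1-\gamma}\Big(\frac1n\mathbf 1^\top(F(Q_k)-Q_k)\Big)\mathbf 1,\qquad k\ge0. \] $\Theta$ denotes the set of deterministic policies $\pi:\mathcal S\to\mathcal A$. For $\pi\in\Theta$, $A_\pi\in\mathbb R^{n\times n}$ has entries $A_\pi((s,a),(s',a')):=\gamma P(s'\mid s,a)$ if $a'=\pi(s')$ and $0$ otherwise, and $\bar A_\pi:=\boldsymbol{\Pi}_\perp A_\pi\boldsymbol{\Pi}_\perp$, regarded as a linear map on $\operatorname{span}(\mathbf 1)^\perp$. The joint spectral radius of a bounded set $\mathcal H$ of linear maps on a finite-dimensional real space is $\rho(\mathcal H):=\lim_{k\to\infty}\sup_{A_1,\dots,A_k\in\mathcal H}\|A_k\cdots A_1\|^{1/k}$ for any submultiplicative operator norm (the value does not depend on the norm). The projected joint spectral radius is $\bar\rho:=\rho(\{\bar A_\pi:\pi\in\Theta\})$; it satisfies $\bar\rho\le\gamma<1$. *)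

(* Defs.v *)
From HB Require Import structures.
From mathcomp Require Import all_boot all_order all_algebra.
From mathcomp Require Import all_classical all_reals all_analysis.

Set Implicit Arguments.
Unset Strict Implicit.
Unset Printing Implicit Defensive.

Import Order.TTheory GRing.Theory Num.Theory.
Import numFieldNormedType.Exports.

Local Open Scope classical_set_scope.
Local Open Scope ring_scope.

Section JointSpectralRadius.
Context {R : realType} {n : nat}.
Implicit Types (x : 'cV[R]_n) (M : 'M[R]_n) (V : set 'cV[R]_n).

Definition norm2 x : R := Num.sqrt (\sum_i x i 0 ^+ 2).

(* Operator norm, induced by the Euclidean norm, of x |-> M *m x regarded as a
   linear map on the subspace V (meaningful when M maps V into V). *)
Definition opnorm_on V M : R :=
  sup [set norm2 (M *m x) | x in [set x | V x /\ norm2 x <= 1]].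

(* The product below is B (k-1) *m ... *m B 0.  The term at k = 0 is
   irrelevant to the limit, and the limit is the same for every
   submultiplicative norm. *)
Definition joint_spectral_radius V (H : set 'M[R]_n) : R :=
  limn (fun k : nat =>
    sup [set opnorm_on V (\big[mulmx/1%:M]_(i < k) B (rev_ord i))
               `^ (k%:R^-1)
        | B in [set B : 'I_k -> 'M[R]_n | forall i, H (B i)]]).

Definition ones : 'cV[R]_n := const_mx 1.

Definition ones_perp : set 'cV[R]_n := [set x | ones^T *m x = 0].

Definition proj_perp : 'M[R]_n := 1%:M - n%:R^-1 *: (ones *m ones^T).

(* n^-1 1^T x, as a scalar. *)
Definition mean x : R := n%:R^-1 * (ones^T *m x) 0 0.

Definition iterates (T : 'cV[R]_n -> 'cV[R]_n) (Q : nat -> 'cV[R]_n) : Prop :=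
  forall k, Q k.+1 = T (Q k).

(* limsup_k |Q_k - q|_2^(1/k), in the extended reals so that no boundedness
   is presupposed. *)
Definition error_rate (q : 'cV[R]_n) (Q : nat -> 'cV[R]_n) : \bar R :=
  limn_esup (fun k : nat => (norm2 (Q k - q) `^ (k%:R^-1))%:E).

Definition worst_case_rate (T : 'cV[R]_n -> 'cV[R]_n) (q : 'cV[R]_n)
    : \bar R :=
  ereal_sup [set error_rate q Q | Q in iterates T].

End JointSpectralRadius.

(* state0 and action0 only witness nonemptiness. *)
Record mdp (R : realType) (S A : finType) := MDP {
  state0 : S;
  action0 : A;
  trans : S -> A -> S -> R;
  trans_ge0 : forall s a s', 0 <= trans s a s';
  trans_sum1 : forall s a, \sum_s' trans s a s' = 1;
  reward : S -> A -> S -> R;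
  discount : R;
  discount_gt0 : 0 < discount;
  discount_lt1 : discount < 1
}.

(* The coordinates of R^n, n = |S||A|, are the pairs (s, a), numbered by
   enum_rank / enum_val. *)
Notation dim S A := #|{: S * A}|.
Notation qvec R S A := ('cV[R]_(dim S A)).

Section Bellman.
Context {R : realType} {S A : finType} (M : mdp R S A).
Local Notation gamma := (discount M).

Definition qval (Q : qvec R S A) (s : S) (a : A) : R := Q (enum_rank (s, a)) 0.

Definition exp_reward (s : S) (a : A) : R :=
  \sum_s' trans M s a s' * reward M s a s'.

(* The default value of the big maximum is itself one of its terms, so this
   is max_a Q(s, a). *)
Definition max_qval (Q : qvec R S A) (s : S) : R :=
  \big[Num.max/qval Q s (action0 M)]_a qval Q s a.

Definition bellman (Q : qvec R S A) : qvec R S A :=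
  \col_i let: (s, a) := enum_val i in
    exp_reward s a + gamma * \sum_s' trans M s a s' * max_qval Q s'.

(* [get] selects the unique fixed point of the Bellman operator, which is a
   gamma-contraction for the sup norm. *)
Definition qstar : qvec R S A := get [set Q | bellman Q = Q].

Definition deflated_step (Q : qvec R S A) : qvec R S A :=
  bellman Q + (gamma / (1 - gamma) * mean (bellman Q - Q)) *: ones.

Definition policy_mx (pi : {ffun S -> A}) : 'M[R]_(dim S A) :=
  \matrix_(i, j) let: (s, a) := enum_val i in let: (s', a') := enum_val j in
    if a' == pi s' then gamma * trans M s a s' else 0.

Definition proj_policy_mx (pi : {ffun S -> A}) : 'M[R]_(dim S A) :=
  proj_perp *m policy_mx pi *m proj_perp.

Definition projected_jsr : R :=
  joint_spectral_radius ones_perp (range proj_policy_mx).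

End Bellman.

(* Main.v *)
Require Import Defs.
From HB Require Import structures.
From mathcomp Require Import all_boot all_order all_algebra.
From mathcomp Require Import all_classical all_reals all_analysis.
From mathcomp Require Import ring lra.

(** Write [e_k = Q_k - Qstar] and let [y_k] be its projection orthogonal to the
    all-ones vector.  Three facts combine.

    The deflation removes the all-ones direction.  The Bellman operator maps
    [Q + c 1] to [F Q + gamma c 1], and the correction term is tuned so that
    the mean of [e_k] drops out altogether: with
    [delta = F (Qstar + y_k) - Qstar], the next error is
    [delta + gamma / (1 - gamma) * mean delta * 1] ([deflated_error]).  Hence
    the whole error [e_(k+1)] is at most a constant times [y_k]
    ([deflated_error_le]), and [y_(k+1)] is the projection of
    [F (Qstar + y_k) - F Qstar].

    The projected Bellman operator contracts at any rate [b] above the joint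
    spectral radius.  For such a [b] there is a norm, equivalent to the
    Euclidean one, in which every projected policy matrix is [b]-Lipschitz
    ([exists_adapted_norm]).  A difference of maxima over actions lies between
    the differences at two actions, so [F (Qstar + y) - F Qstar] is obtained by
    backing up a point of a box whose vertices are the deterministic policies
    applied to [y]; since a norm is convex, the bound at the vertices holds on
    the whole box ([box_convex_le], [proj_bellman_adapted]).  The joint spectral
    radius is thus only ever used for the finitely many deterministic policies.

    The adapted norm exists because products of length [k] are [O(b ^ k)].
    The joint spectral radius is given as a limit; that the limit exists and is
    the infimum over [k] of the normalized suprema is Fekete's lemma
    ([sup_root_norms_cvg]), and a single length beating [b] then controls all
    lengths ([products_geometric]).

    The limsup bound follows by letting [b] decrease to the joint spectral
    radius.  For undeflated iteration, the contraction property gives the rate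
    [gamma] from above, and the start [Qstar + 1] attains it. *)

Set Implicit Arguments.
Unset Strict Implicit.
Unset Printing Implicit Defensive.

Import Order.TTheory GRing.Theory Num.Theory.
Import numFieldNormedType.Exports.

Local Open Scope classical_set_scope.
Local Open Scope ring_scope.

(** * Growth rates of geometric sequences *)

Section Rates.
Context {R : realType}.
Implicit Types b c : R.

Lemma root_cvg1 c : 0 < c -> c `^ (k%:R^-1) @[k --> \oo] --> (1 : R).
Proof.
move=> c0; rewrite /powR gt_eqF//.
suff h : (k%:R^-1 * ln c) @[k --> \oo] --> (0 : R).
  by rewrite -[X in _ --> X]expR0; exact: (continuous_cvg _ (@continuous_expR R 0) h).
rewrite -[X in _ --> X](mul0r (ln c)); apply: cvgMr_tmp.
by rewrite -(cvg_shiftS (fun k : nat => k%:R^-1 : R)); exact: cvg_harmonic.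
Qed.

Lemma root_expr b k : 0 <= b -> (0 < k)%N -> (b ^+ k) `^ (k%:R^-1) = b.
Proof.
move=> b0 k0.
by rewrite -powR_mulrn// -powRrM divff ?powRr1// pnatr_eq0 -lt0n.
Qed.

Lemma root_geometric_cvg c b : 0 < c -> 0 <= b ->
  (c * b ^+ k) `^ (k%:R^-1) @[k --> \oo] --> b.
Proof.
move=> c0 b0; rewrite -[X in _ --> X](mul1r b).
apply: cvg_trans (cvgMr_tmp (root_cvg1 c0)); apply: near_eq_cvg.
exists 1%N => // k /= k0.
by rewrite powRM ?exprn_ge0 ?(ltW c0)// root_expr.
Qed.

(** The constant [c] is invisible to the root rate, since its [k]-th root tends
    to 1. *)
Lemma limn_esup_root_le (u : nat -> R) c b : 0 < c -> 0 <= b ->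
  (forall k, 0 <= u k) -> (forall k, (0 < k)%N -> u k <= c * b ^+ k) ->
  (limn_esup (fun k => (u k `^ (k%:R^-1))%:E) <= b%:E)%E.
Proof.
move=> c0 b0 u0 ub; apply/lee_addgt0Pr => e e0.
have [N _ hN] : \forall k \near \oo, (c * b ^+ k) `^ (k%:R^-1) <= b + e.
  by apply: (cvgr_le _ (root_geometric_cvg c0 b0)); rewrite ltrDl.
apply: ge_ereal_inf; eexists.
  by exists [set k | (maxn 1 N <= k)%N] => //; exists (maxn 1 N).
apply/ereal_supP => y [k /=]; rewrite geq_max => /andP[k0 Nk] <-{y}.
rewrite -EFinD lee_fin; apply: le_trans (hN k Nk).
apply: ge0_ler_powR; rewrite ?invr_ge0 ?nnegrE//.
  by rewrite mulr_ge0 ?exprn_ge0 ?(ltW c0).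
exact: ub.
Qed.

End Rates.

(** * The Euclidean norm *)

Section EuclideanNorm.
Context {R : realType} {n : nat}.
Implicit Types (x y : 'cV[R]_n) (M : 'M[R]_n).

Lemma norm2_ge0 x : 0 <= norm2 x.
Proof. exact: sqrtr_ge0. Qed.

Lemma sumsq_ge0 x : 0 <= \sum_i x i 0 ^+ 2.
Proof. by apply: sumr_ge0 => i _; exact: sqr_ge0. Qed.

Lemma norm2_sqr x : norm2 x ^+ 2 = \sum_i x i 0 ^+ 2.
Proof. by rewrite sqr_sqrtr// sumsq_ge0. Qed.

Lemma norm2Z a x : norm2 (a *: x) = `|a| * norm2 x.
Proof.
rewrite /norm2 (eq_bigr (fun i => a ^+ 2 * x i 0 ^+ 2)).
  by rewrite -mulr_sumr sqrtrM ?sqr_ge0// sqrtr_sqr.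
by move=> i _; rewrite mxE exprMn.
Qed.

Lemma norm2_0 : norm2 (0 : 'cV[R]_n) = 0.
Proof. by rewrite -[0](scale0r 0) norm2Z normr0 mul0r. Qed.

Lemma coord_le_norm x i : `|x i 0| <= `|x|.
Proof.
by rewrite [leRHS]/Num.norm /= mx_normrE; apply/bigmax_geP; right; exists (i, 0).
Qed.

Lemma norm_le_coord x b : 0 <= b -> (forall i, `|x i 0| <= b) -> `|x| <= b.
Proof.
move=> b0 xb; rewrite [leLHS]/Num.norm /= mx_normrE.
by apply/bigmax_leP; split => // -[i j] _ /=; rewrite (ord1 j).
Qed.

Lemma norm_le_norm2 x : `|x| <= norm2 x.
Proof.
apply: norm_le_coord; first exact: norm2_ge0.
move=> i; rewrite -(ger0_norm (norm2_ge0 x)) -ler_sqr ?nnegrE//.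
rewrite -!normrX !ger0_norm ?sqr_ge0// norm2_sqr (bigD1 i)//= lerDl.
by apply: sumr_ge0 => j _; exact: sqr_ge0.
Qed.

Lemma norm2_le_norm x : norm2 x <= Num.sqrt n%:R * `|x|.
Proof.
rewrite -[`|x|]ger0_norm// -sqrtr_sqr -sqrtrM ?ler0n// ler_wsqrtr//.
apply: (@le_trans _ _ (\sum_(i < n) `|x| ^+ 2)).
  apply: ler_sum => i _.
  by rewrite -(ger0_norm (sqr_ge0 _)) normrX lerXn2r ?nnegrE// coord_le_norm.
by rewrite sumr_const card_ord mulr_natl.
Qed.

Lemma norm2_eq0 x : norm2 x = 0 -> x = 0.
Proof.
by move=> x0; have := norm_le_norm2 x; rewrite x0 normr_le0 => /eqP.
Qed.

(** Summing [(x_i + y_i)^2 <= (1 + b/a) x_i^2 + (1 + a/b) y_i^2] with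
    [a = norm2 x] and [b = norm2 y] gives exactly [(a + b)^2]. *)
Lemma norm2D x y : norm2 (x + y) <= norm2 x + norm2 y.
Proof.
have [a0|a0] := eqVneq (norm2 x) 0; first by rewrite (norm2_eq0 a0) norm2_0 !add0r.
have [b0|b0] := eqVneq (norm2 y) 0; first by rewrite (norm2_eq0 b0) norm2_0 !addr0.
have {}a0 : 0 < norm2 x by rewrite lt0r a0 norm2_ge0.
have {}b0 : 0 < norm2 y by rewrite lt0r b0 norm2_ge0.
rewrite -ler_sqr ?nnegrE ?addr_ge0 ?norm2_ge0// norm2_sqr.
set a := norm2 x in a0 *; set b := norm2 y in b0 *.
have -> : (a + b) ^+ 2 = (1 + b / a) * \sum_i x i 0 ^+ 2
                       + (1 + a / b) * \sum_i y i 0 ^+ 2.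
  by rewrite -!norm2_sqr -/a -/b; field; rewrite !gt_eqF.
rewrite !mulr_sumr -big_split/=; apply: ler_sum => i _; rewrite mxE -subr_ge0.
have -> : (1 + b / a) * x i 0 ^+ 2 + (1 + a / b) * y i 0 ^+ 2
  - (x i 0 + y i 0) ^+ 2 = (b * x i 0 - a * y i 0) ^+ 2 / (a * b).
  by field; rewrite !gt_eqF.
by rewrite divr_ge0 ?sqr_ge0// mulr_ge0// ltW.
Qed.

Lemma norm2_mulmx_bounded M : {c : R | 0 <= c &
  forall x, norm2 (M *m x) <= c * norm2 x}.
Proof.
exists (Num.sqrt n%:R * \sum_i \sum_j `|M i j|).
  by rewrite mulr_ge0 ?sqrtr_ge0// !sumr_ge0// => i _; rewrite sumr_ge0.
move=> x; apply: le_trans (norm2_le_norm _) _; rewrite -mulrA.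
apply: ler_wpM2l; first exact: sqrtr_ge0.
have S0 i : 0 <= \sum_j `|M i j| by rewrite sumr_ge0.
apply: norm_le_coord => [|i]; first by rewrite mulr_ge0 ?norm2_ge0// sumr_ge0.
apply: (@le_trans _ _ ((\sum_j `|M i j|) * norm2 x)).
  rewrite mxE mulr_suml; apply: le_trans (ler_norm_sum _ _ _) _.
  apply: ler_sum => j _; rewrite normrM ler_wpM2l//.
  exact: le_trans (coord_le_norm _ _) (norm_le_norm2 _).
apply: ler_wpM2r; first exact: norm2_ge0.
by rewrite [leRHS](bigD1 i)//= lerDl sumr_ge0.
Qed.

End EuclideanNorm.

(** * Products of matrices and the joint spectral radius *)

Section Products.
Context {R : realType} {n : nat} (H : set 'M[R]_n).
Implicit Types (A N : 'M[R]_n).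

(** The products in the definition of [joint_spectral_radius], gathered into a
    set so that they can be cut and extended without reindexing. *)
Definition products (k : nat) : set 'M[R]_n :=
  [set \big[mulmx/1%:M]_(i < k) B (rev_ord i)
  | B in [set B : 'I_k -> 'M[R]_n | forall i, H (B i)]].

Lemma products0 N : products 0 N <-> N = 1%:M.
Proof.
split=> [[B _ <-]|->]; first by rewrite big_ord0.
by exists (fun=> 0); [case|rewrite big_ord0].
Qed.

Lemma products_cons k A N :
  H A -> products k N -> products k.+1 (A *m N).
Proof.
move=> HA [B HB <-].
exists (fun i => if unlift ord_max i is Some j then B j else A) => [i|].
  by case: unliftP => [j|] _.
rewrite big_ord_recl; congr (_ *m _).
  have -> : rev_ord ord0 = ord_max :> 'I_k.+1 by apply: val_inj; rewrite /= subn1.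
  by rewrite unlift_none.
apply: eq_bigr => i _.
suff -> : rev_ord (lift ord0 i) = lift ord_max (rev_ord i) :> 'I_k.+1.
  by rewrite liftK.
by apply: ord_inj; rewrite lift_max.
Qed.

Lemma products_uncons k N : products k.+1 N ->
  exists A N', [/\ H A, products k N' & N = A *m N'].
Proof.
move=> [B HB <-]; exists (B ord_max).
exists (\big[mulmx/1%:M]_(i < k) B (lift ord_max (rev_ord i))); split => //.
  by exists (B \o lift ord_max) => // i; exact: HB.
rewrite big_ord_recl; congr (_ *m _); first by congr B; apply: val_inj; rewrite /= subn1.
by apply: eq_bigr => i _; congr B; apply: ord_inj; rewrite [RHS]lift_max.
Qed.

Lemma products_rcons k A N :
  H A -> products k N -> products k.+1 (N *m A).
Proof.
move=> HA; elim: k N => [N /products0 ->|k IH N /products_uncons].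
  by rewrite mul1mx -[A]mulmx1; apply: products_cons => //; exact/products0.
move=> [A' [N' [HA' pN' ->]]]; rewrite -mulmxA.
by apply: products_cons => //; exact: IH.
Qed.

Lemma products_split a b N : products (a + b) N ->
  exists N1 N2, [/\ products a N1, products b N2 & N = N1 *m N2].
Proof.
elim: a N => [N pN|a IH N].
  by exists 1%:M, N; split => //; [exact/products0|rewrite mul1mx].
rewrite addSn => /products_uncons[A [N' [HA /IH[N1 [N2 [pN1 pN2 ->]]] ->]]].
by exists (A *m N1), N2; split => //; [exact: products_cons|rewrite mulmxA].
Qed.

Lemma products_nonempty k : H !=set0 -> products k !=set0.
Proof.
move=> [A HA]; elim: k => [|k [N pN]]; first by exists 1%:M; exact/products0.
by exists (A *m N); exact: products_cons.
Qed.

End Products.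

Section OperatorNorm.
Context {R : realType} {n : nat} (V : set 'cV[R]_n).
Context (V0 : V 0) (VZ : forall a x, V x -> V (a *: x)).
Implicit Types (M : 'M[R]_n) (x : 'cV[R]_n).

Lemma opnorm_on_has_sup M :
  has_sup [set norm2 (M *m x) | x in [set x | V x /\ norm2 x <= 1]].
Proof.
split; first by exists (norm2 (M *m 0)), 0 => //=; rewrite norm2_0.
have [c c0 hc] := norm2_mulmx_bounded M.
exists c => _ [x [_ x1] <-]; apply: le_trans (hc x) _.
by rewrite -[leRHS]mulr1 ler_wpM2l.
Qed.

Lemma opnorm_on_ge0 M : 0 <= opnorm_on V M.
Proof.
apply: sup_ubound; first exact: (opnorm_on_has_sup M).2.
by exists 0 => /=; rewrite ?mulmx0 norm2_0.
Qed.

Lemma opnorm_on_le M t : 0 <= t ->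
  (forall x, V x -> norm2 (M *m x) <= t * norm2 x) -> opnorm_on V M <= t.
Proof.
move=> t0 hM; apply: ge_sup; first exact: (opnorm_on_has_sup M).1.
move=> _ [x [Vx x1] <-]; apply: le_trans (hM x Vx) _.
by rewrite -[leRHS]mulr1 ler_wpM2l.
Qed.

Lemma norm2_mulmx_le M x : V x -> norm2 (M *m x) <= opnorm_on V M * norm2 x.
Proof.
move=> Vx; have [x0|x0] := eqVneq (norm2 x) 0.
  by rewrite (norm2_eq0 x0) mulmx0 norm2_0 mulr0.
have {}x0 : 0 < norm2 x by rewrite lt0r x0 norm2_ge0.
rewrite -ler_pdivrMr// mulrC -[(_)^-1]ger0_norm ?invr_ge0 ?norm2_ge0//.
rewrite -norm2Z scalemxAr; apply: sup_ubound; first exact: (opnorm_on_has_sup M).2.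
exists ((norm2 x)^-1 *: x) => //; split; first exact: VZ.
by rewrite norm2Z ger0_norm ?invr_ge0 ?norm2_ge0// mulVf// gt_eqF.
Qed.

End OperatorNorm.

(** A sublinear equivalent of [norm2] on [V] that turns an asymptotic growth
    rate [b] of the products from [H] into a one-step Lipschitz constant. *)
Definition adapted_to {R : realType} {n : nat} (V : set 'cV[R]_n)
    (H : set 'M[R]_n) (b K : R) (v : 'cV[R]_n -> R) : Prop :=
  [/\ forall x, V x -> norm2 x <= v x <= K * norm2 x,
      forall x y, V x -> V y -> v (x + y) <= v x + v y,
      forall a x, 0 <= a -> V x -> v (a *: x) <= a * v x
    & forall A x, H A -> V x -> v (A *m x) <= b * v x].

Section JointSpectralRadiusTheory.
Context {R : realType} {n : nat} (V : set 'cV[R]_n) (H : set 'M[R]_n).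
Context (V0 : V 0) (VZ : forall a x, V x -> V (a *: x)).
Context (H_neq0 : H !=set0) (HV : forall A x, H A -> V x -> V (A *m x)).
Context (c : R) (c_ge0 : 0 <= c).
Context (Hc : forall A x, H A -> V x -> norm2 (A *m x) <= c * norm2 x).
Implicit Types (A N : 'M[R]_n) (x : 'cV[R]_n).

Lemma products_stable k N x : products H k N -> V x -> V (N *m x).
Proof.
elim: k N => [N /products0 ->|k IH N]; first by rewrite mul1mx.
move=> /products_uncons[A [N' [HA pN' ->]]] Vx.
by rewrite -mulmxA; apply: HV => //; exact: IH.
Qed.

Lemma products_le_exp k N x :
  products H k N -> V x -> norm2 (N *m x) <= c ^+ k * norm2 x.
Proof.
elim: k N => [N /products0 ->|k IH N]; first by rewrite mul1mx mul1r.
move=> /products_uncons[A [N' [HA pN' ->]]] Vx.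
rewrite -mulmxA exprS -mulrA.
apply: le_trans (Hc HA (products_stable pN' Vx)) _.
by rewrite ler_wpM2l// IH.
Qed.

Definition root_norms k : set R :=
  [set opnorm_on V N `^ (k%:R^-1) | N in products H k].

Lemma joint_spectral_radiusE :
  joint_spectral_radius V H = limn (fun k => sup (root_norms k)).
Proof.
congr (limn _); apply: funext => k; congr sup; apply/seteqP; split.
  move=> _ [B HB <-]; eexists; last by [].
  by exists B.
by move=> _ [N [B HB <-] <-]; exists B.
Qed.

Lemma root_norms_has_sup k : (0 < k)%N -> has_sup (root_norms k).
Proof.
move=> k0; split.
  have [N pN] := products_nonempty k H_neq0.
  by exists (opnorm_on V N `^ (k%:R^-1)), N.
exists c => _ [N pN <-]; rewrite -(root_expr c_ge0 k0).
apply: ge0_ler_powR; rewrite ?invr_ge0 ?nnegrE ?exprn_ge0 ?opnorm_on_ge0//.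
by apply: opnorm_on_le => [//||x Vx]; [rewrite exprn_ge0|exact: products_le_exp].
Qed.

Lemma sup_root_norms_ge0 k : (0 < k)%N -> 0 <= sup (root_norms k).
Proof.
move=> k0; have [[_ [N pN _]] ub] := root_norms_has_sup k0.
apply: (@le_trans _ _ (opnorm_on V N `^ (k%:R^-1))); first exact: powR_ge0.
by apply: (sup_ubound ub); exists N.
Qed.

Lemma products_le_root_sup k N x : (0 < k)%N -> products H k N -> V x ->
  norm2 (N *m x) <= sup (root_norms k) ^+ k * norm2 x.
Proof.
move=> k0 pN Vx; apply: le_trans (norm2_mulmx_le V0 VZ N Vx) _.
apply: ler_wpM2r; first exact: norm2_ge0.
have <- : (opnorm_on V N `^ (k%:R^-1)) ^+ k = opnorm_on V N.
  rewrite -powR_mulrn ?powR_ge0// -powRrM mulVf ?powRr1 ?opnorm_on_ge0//.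
  by rewrite pnatr_eq0 -lt0n.
apply: lerXn2r; rewrite ?nnegrE ?powR_ge0 ?sup_root_norms_ge0//.
by apply: sup_ubound; [exact: (root_norms_has_sup k0).2|exists N].
Qed.

Lemma sup_root_norms_le k t : (0 < k)%N -> 0 <= t ->
  (forall N x, products H k N -> V x -> norm2 (N *m x) <= t * norm2 x) ->
  sup (root_norms k) <= t `^ (k%:R^-1).
Proof.
move=> k0 t0 ht; apply: ge_sup; first exact: (root_norms_has_sup k0).1.
move=> _ [N pN <-].
apply: ge0_ler_powR; rewrite ?invr_ge0 ?nnegrE ?opnorm_on_ge0//.
by apply: opnorm_on_le => // x Vx; exact: ht.
Qed.

(** A bound on the products of one length [m] spreads to all lengths: a long
    product is cut into blocks of length [m], and the remaining fewer than [m]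
    factors only cost the constant [K]. *)
Lemma products_geometric m b : (0 < m)%N -> 0 < b ->
  (forall N x, products H m N -> V x -> norm2 (N *m x) <= b ^+ m * norm2 x) ->
  {K : R | 0 < K & forall k N x, products H k N -> V x ->
     norm2 (N *m x) <= K * b ^+ k * norm2 x}.
Proof.
(* One leftover factor costs at most [c], hence at most [d * b]. *)
move=> m0 b0 hm; set d := Num.max 1 (c / b).
have d1 : 1 <= d by rewrite le_max lexx.
have d0 : 0 < d by exact: lt_le_trans d1.
exists (d ^+ m); first by rewrite exprn_gt0.
elim/ltn_ind => k IH N x pN Vx; have [km|mk] := ltnP k m.
  apply: le_trans (products_le_exp pN Vx) _.
  apply: ler_wpM2r; first exact: norm2_ge0.
  apply: (@le_trans _ _ ((d * b) ^+ k)).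
    apply: lerXn2r; rewrite ?nnegrE//.
      by rewrite ltW// mulr_gt0.
    by rewrite -ler_pdivrMr// le_max lexx orbT.
  rewrite exprMn ler_wpM2r ?exprn_ge0 ?(ltW b0)//.
  by rewrite ler_weXn2l// ltnW.
move: pN; rewrite -{1}(subnKC mk) => /products_split[N1 [N2 [p1 p2 ->]]].
rewrite -mulmxA; apply: le_trans (hm _ _ p1 (products_stable p2 Vx)) _.
have kmk : (k - m < k)%N by rewrite ltn_subrL m0 (leq_trans m0).
apply: le_trans (ler_wpM2l _ (IH _ kmk _ _ p2 Vx)) _.
  by rewrite exprn_ge0// ltW.
by rewrite !mulrA [_ * d ^+ m]mulrC -(mulrA (d ^+ m)) -exprD subnKC.
Qed.

Definition root_inf : R := inf [set sup (root_norms k) | k in [set k | (0 < k)%N]].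

Lemma root_inf_has_inf :
  has_inf [set sup (root_norms k) | k in [set k | (0 < k)%N]].
Proof.
split; first by exists (sup (root_norms 1)), 1%N.
by exists 0 => _ [k k0 <-]; exact: sup_root_norms_ge0.
Qed.

Lemma root_inf_ge0 : 0 <= root_inf.
Proof.
apply: lb_le_inf; first exact: root_inf_has_inf.1.
by move=> _ [k k0 <-]; exact: sup_root_norms_ge0.
Qed.

Lemma products_growth_inf b : root_inf < b ->
  {K : R | 0 < K & forall k N x, products H k N -> V x ->
     norm2 (N *m x) <= K * b ^+ k * norm2 x}.
Proof.
move=> Lb; have b0 : 0 < b by exact: le_lt_trans root_inf_ge0 Lb.
have /cid[m [m0 hm]] : exists m, (0 < m)%N /\ sup (root_norms m) < b.
  by have [_ [m m0 <-] hm] := inf_lt root_inf_has_inf.1 Lb; exists m.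
apply: (products_geometric m0 b0) => N x pN Vx.
apply: le_trans (products_le_root_sup m0 pN Vx) _.
apply: ler_wpM2r; first exact: norm2_ge0.
by apply: lerXn2r; rewrite ?nnegrE ?sup_root_norms_ge0 ?(ltW b0) ?(ltW hm).
Qed.

(** Fekete's subadditive lemma, in multiplicative form: once some length comes
    close to the infimum, [products_geometric] bounds every longer length up
    to a constant, whose [k]-th root tends to 1. *)
Lemma sup_root_norms_cvg : sup (root_norms k) @[k --> \oo] --> root_inf.
Proof.
apply/cvgrPdistC_le => e e0.
have e2 : root_inf < root_inf + e / 2 by rewrite ltrDl divr_gt0.
have b0 : 0 <= root_inf + e / 2 by rewrite ltW// (le_lt_trans root_inf_ge0).
have [K K0 hK] := products_growth_inf e2.
have : \forall k \near \oo,
    (K * (root_inf + e / 2) ^+ k) `^ (k%:R^-1) <= root_inf + e.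
  apply: (cvgr_le _ (root_geometric_cvg K0 b0)).
  by rewrite ltrD2l ltr_pdivrMr// ltr_pMr// ltr1n.
move=> [N _ hN]; exists (maxn 1 N) => // k /=.
rewrite geq_max => /andP[k0 Nk]; rewrite ger0_norm; last first.
  by rewrite subr_ge0; apply: inf_lbound; [exact: root_inf_has_inf.2|exists k].
rewrite lerBlDl; apply: le_trans (hN k Nk).
apply: sup_root_norms_le => [//||N' x pN Vx]; last exact: hK.
by rewrite mulr_ge0 ?exprn_ge0// ltW.
Qed.

Lemma jsr_eq_inf : joint_spectral_radius V H = root_inf.
Proof.
by rewrite joint_spectral_radiusE; apply: cvg_lim => //; exact: sup_root_norms_cvg.
Qed.

Lemma jsr_ge0 : 0 <= joint_spectral_radius V H.
Proof. by rewrite jsr_eq_inf root_inf_ge0. Qed.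

Lemma products_growth b : joint_spectral_radius V H < b ->
  {K : R | 0 < K & forall k N x, products H k N -> V x ->
     norm2 (N *m x) <= K * b ^+ k * norm2 x}.
Proof. by rewrite jsr_eq_inf; exact: products_growth_inf. Qed.

(** The norm adapted to [b] (Rota and Strang): rescaling the products of
    length [k] by [b ^- k] keeps their values at [x] bounded, and a factor
    [A] applied to [x] is absorbed into a product one longer, at the cost of
    a single [b].  Being convex, the result also controls convex combinations
    of members of [H], whose products never have to be expanded. *)
Definition adapted_values b x : set R :=
  [set y | exists k N, products H k N /\ y = norm2 (N *m x) / b ^+ k].

Definition adapted_norm b x : R := sup (adapted_values b x).

Context (b : R) (jsr_lt : joint_spectral_radius V H < b).
Local Notation v := (adapted_norm b).

Let b_gt0 : 0 < b. Proof. exact: le_lt_trans jsr_ge0 jsr_lt. Qed.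

Let adapted_le_cst x t :
  (forall k N, products H k N -> norm2 (N *m x) <= t * b ^+ k) -> v x <= t.
Proof.
move=> ht; apply: ge_sup.
  by exists (norm2 (1%:M *m x) / b ^+ 0), 0%N, 1%:M; split => //; exact/products0.
move=> _ [k [N [pN ->]]]; rewrite ler_pdivrMr ?exprn_gt0//; exact: ht.
Qed.

Let le_adapted k N x : V x -> products H k N ->
  norm2 (N *m x) <= v x * b ^+ k.
Proof.
move=> Vx pN; rewrite -ler_pdivrMr ?exprn_gt0//.
apply: sup_ubound; last by exists k, N.
have [K K0 hK] := products_growth jsr_lt.
exists (K * norm2 x) => _ [j [N' [pN' ->]]].
by rewrite ler_pdivrMr ?exprn_gt0// mulrAC; exact: hK.
Qed.

Lemma norm2_le_adapted x : V x -> norm2 x <= v x.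
Proof.
move=> Vx; have : norm2 (1%:M *m x) <= v x * b ^+ 0.
  by apply: le_adapted => //; exact/products0.
by rewrite mul1mx mulr1.
Qed.

Lemma adapted_le_norm2 : {K : R | 0 < K & forall x, V x -> v x <= K * norm2 x}.
Proof.
have [K K0 hK] := products_growth jsr_lt.
exists K => // x Vx; apply: adapted_le_cst => k N pN.
by rewrite mulrAC; exact: hK.
Qed.

Lemma adaptedD x y : V x -> V y -> v (x + y) <= v x + v y.
Proof.
move=> Vx Vy; apply: adapted_le_cst => k N pN.
rewrite mulmxDr mulrDl; apply: le_trans (norm2D _ _) _.
by rewrite lerD// le_adapted.
Qed.

Lemma adaptedZ a x : 0 <= a -> V x -> v (a *: x) <= a * v x.
Proof.
move=> a0 Vx; apply: adapted_le_cst => k N pN.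
by rewrite -scalemxAr norm2Z ger0_norm// -mulrA ler_wpM2l// le_adapted.
Qed.

Lemma adapted_contract A x : H A -> V x -> v (A *m x) <= b * v x.
Proof.
move=> HA Vx; apply: adapted_le_cst => k N pN.
rewrite mulmxA mulrAC -exprS mulrC; apply: le_adapted => //.
exact: products_rcons.
Qed.

Lemma exists_adapted_norm : exists v K, 0 < K /\ adapted_to V H b K v.
Proof.
have [K K0 hK] := adapted_le_norm2; exists v, K; split => //; split.
- by move=> x Vx; rewrite norm2_le_adapted//= hK.
- exact: adaptedD.
- exact: adaptedZ.
- exact: adapted_contract.
Qed.

End JointSpectralRadiusTheory.

(** * The mean and the projection along the all-ones vector *)

Section Projection.
Context {R : realType} {n : nat}.
Implicit Types x y : 'cV[R]_n.

Lemma meanE x : mean x = n%:R^-1 * \sum_i x i 0.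
Proof.
rewrite /mean mxE; congr (_ * _).
by apply: eq_bigr => i _; rewrite !mxE mul1r.
Qed.

Lemma meanB x y : mean (x - y) = mean x - mean y.
Proof. by rewrite /mean mulmxBr !mxE mulrBr. Qed.

Lemma meanZ a x : mean (a *: x) = a * mean x.
Proof. by rewrite /mean -scalemxAr !mxE mulrCA. Qed.

Lemma meanD x y : mean (x + y) = mean x + mean y.
Proof. by rewrite /mean mulmxDr !mxE mulrDr. Qed.

Lemma proj_perpE x : proj_perp *m x = x - mean x *: ones.
Proof.
rewrite /proj_perp mulmxBl mul1mx -scalemxAl -mulmxA.
by rewrite [ones^T *m x]mx11_scalar mul_mx_scalar scalerA.
Qed.

Lemma ones_perp0 : ones_perp (0 : 'cV[R]_n).
Proof. by rewrite /ones_perp/= mulmx0. Qed.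

Lemma ones_perpZ a x : ones_perp x -> ones_perp (a *: x).
Proof. by rewrite /ones_perp/= -scalemxAr => ->; rewrite scaler0. Qed.

Lemma proj_perp_id x : ones_perp x -> proj_perp *m x = x.
Proof. by move=> Vx; rewrite proj_perpE /mean Vx mxE mulr0 scale0r subr0. Qed.

Context (n_gt0 : (0 < n)%N).

Let n_neq0 : n%:R != 0 :> R. Proof. by rewrite pnatr_eq0 -lt0n. Qed.

Lemma mean_ones : mean (ones : 'cV[R]_n) = 1.
Proof.
rewrite meanE (eq_bigr (fun=> 1)) => [|i _]; last by rewrite mxE.
by rewrite sumr_const card_ord mulVf.
Qed.

Lemma ones_perp_mean0 x : mean x = 0 -> ones_perp x.
Proof.
move=> /eqP; rewrite mulf_eq0 invr_eq0 (negbTE n_neq0)/= => /eqP x0.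
by rewrite /ones_perp/= [_ *m x]mx11_scalar x0 raddf0.
Qed.

Lemma ones_perp_proj x : ones_perp (proj_perp *m x).
Proof.
by apply: ones_perp_mean0; rewrite proj_perpE meanB meanZ mean_ones mulr1 subrr.
Qed.

Lemma normr_mean_le x : `|mean x| <= `|x|.
Proof.
rewrite meanE normrM gtr0_norm ?invr_gt0 ?ltr0n// mulrC ler_pdivrMr ?ltr0n//.
apply: le_trans (ler_norm_sum _ _ _) _; rewrite mulr_natr.
apply: le_trans (ler_sum _ (fun i _ => coord_le_norm x i)) _.
by rewrite sumr_const card_ord.
Qed.

Lemma normr_ones : `|ones : 'cV[R]_n| = 1.
Proof.
apply/eqP; rewrite eq_le; apply/andP; split.
  by apply: norm_le_coord => // i; rewrite mxE normr1.
by have := normr_mean_le ones; rewrite mean_ones normr1.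
Qed.

Lemma norm2_ones_gt0 : 0 < norm2 (ones : 'cV[R]_n).
Proof. by apply: lt_le_trans (norm_le_norm2 _); rewrite normr_ones. Qed.

End Projection.

(** * The Bellman operator *)

(** Joins the completeness of matrices with their normed-module structure, as
    Banach's fixed-point theorem demands. *)
HB.instance Definition _ (R : realType) (m n : nat) :=
  NormedModule.on 'M[R]_(m, n).

Section BellmanTheory.
Context {R : realType} {S A : finType} (M : mdp R S A).
Local Notation gamma := (discount M).
Implicit Types (Q y : qvec R S A) (m f g : S -> R).

Lemma dim_gt0 : (0 < #|{: S * A}|)%N.
Proof. by apply/card_gt0P; exists (state0 M, action0 M). Qed.

(** The discounted expectation of next-state values, that is, the linear part
    of the Bellman operator once the maximum over actions has been taken. *)
Definition backup m : qvec R S A :=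
  \col_i let: (s, a) := enum_val i in gamma * \sum_s' trans M s a s' * m s'.

Lemma bellmanB Q Q' :
  bellman M Q - bellman M Q' = backup (fun s => max_qval M Q s - max_qval M Q' s).
Proof.
apply/colP => i; rewrite !mxE; case: (enum_val i) => s a.
rewrite [exp_reward _ _ _ + _]addrC addrKA -mulrBr -sumrB; congr (_ * _).
apply: eq_bigr => s' _.
by rewrite mulrBr.
Qed.

Lemma backup_linear c d f g :
  backup (fun s => c * f s + d * g s) = c *: backup f + d *: backup g.
Proof.
apply/colP => i; rewrite !mxE; case: (enum_val i) => s a.
rewrite !mulr_sumr -big_split /=.
by apply: eq_bigr => s' _; ring.
Qed.

Lemma backup_cst c : backup (fun=> c) = (gamma * c) *: ones.
Proof.
apply/colP => i; rewrite !mxE; case: (enum_val i) => s a.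
by rewrite -mulr_suml trans_sum1 mul1r mulr1.
Qed.

Lemma normr_backup_le m t : 0 <= t -> (forall s, `|m s| <= t) ->
  `|backup m| <= gamma * t.
Proof.
have g0 := ltW (discount_gt0 M).
move=> t0 mt; apply: norm_le_coord => [|i]; first exact: mulr_ge0.
rewrite mxE; case: (enum_val i) => s a; rewrite normrM ger0_norm// ler_wpM2l//.
apply: le_trans (ler_norm_sum _ _ _) _.
apply: (@le_trans _ _ (\sum_s' trans M s a s' * t)).
  apply: ler_sum => s' _.
  by rewrite normrM ger0_norm ?trans_ge0// ler_wpM2l ?trans_ge0.
by rewrite -mulr_suml trans_sum1 mul1r.
Qed.

Lemma policy_mx_backup (pi : {ffun S -> A}) y :
  policy_mx M pi *m y = backup (fun s => qval y s (pi s)).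
Proof.
apply/colP => i; rewrite !mxE.
transitivity (\sum_j let: (s, a) := enum_val i in let: (s', a') := enum_val j in
    if a' == pi s' then gamma * trans M s a s' * y j 0 else 0).
  apply: eq_bigr => j _; rewrite !mxE.
  case: (enum_val i) (enum_val j) => s a [s' a'].
  by case: ifP; rewrite ?mul0r.
case: (enum_val i) => s a.
rewrite (reindex enum_rank) /=; last by apply: onW_bij; exact: enum_rank_bij.
transitivity (\sum_s' \sum_a' if a' == pi s'
    then gamma * trans M s a s' * y (enum_rank (s', a')) 0 else 0).
  by rewrite pair_bigA; apply: eq_bigr => -[s' a'] _; rewrite enum_rankK.
rewrite mulr_sumr; apply: eq_bigr => s' _.
by rewrite -big_mkcond big_pred1_eq mulrA.
Qed.

Lemma qval_le_max Q s a : qval Q s a <= max_qval M Q s.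
Proof. exact: (le_bigmax _ (fun a => qval Q s a)). Qed.

Lemma max_qval_attained Q s : exists a, max_qval M Q s = qval Q s a.
Proof.
rewrite /max_qval; elim/big_ind: _ => [|x y [a ->] [b ->]|a _].
- by exists (action0 M).
- by case: leP => _; [exists b|exists a].
- by exists a.
Qed.

Lemma qvalB Q Q' s a : qval (Q - Q') s a = qval Q s a - qval Q' s a.
Proof. by rewrite /qval !mxE. Qed.

(** The witnesses are maximizing actions: [b] for [Q], since [max_qval Q'] is at
    least the value of [Q'] there, and [a] for [Q']. *)
Lemma max_qvalB_between Q Q' s : exists a b,
  qval (Q - Q') s a <= max_qval M Q s - max_qval M Q' s <= qval (Q - Q') s b.
Proof.
have [b Qb] := max_qval_attained Q s; have [a Qa] := max_qval_attained Q' s.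
exists a, b; rewrite !qvalB; apply/andP; split.
  by rewrite Qa lerD2r qval_le_max.
by rewrite Qb lerD2l lerN2 qval_le_max.
Qed.

Lemma bellman_contraction Q Q' :
  `|bellman M Q - bellman M Q'| <= gamma * `|Q - Q'|.
Proof.
rewrite bellmanB; apply: normr_backup_le => // s.
have [a [b /andP[ha hb]]] := max_qvalB_between Q Q' s.
have ha' := coord_le_norm (Q - Q') (enum_rank (s, a)).
have hb' := coord_le_norm (Q - Q') (enum_rank (s, b)).
move: ha' hb'; rewrite !ler_norml => /andP[la _] /andP[_ ub]; apply/andP; split.
  exact: le_trans la ha.
exact: le_trans hb ub.
Qed.

Lemma max_qvalD_ones Q c s : max_qval M (Q + c *: ones) s = max_qval M Q s + c.
Proof.
have qc a : qval (Q + c *: ones) s a = qval Q s a + c by rewrite /qval !mxE mulr1.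
have [a Qa] := max_qval_attained (Q + c *: ones) s.
have [b Qb] := max_qval_attained Q s.
apply/eqP; rewrite eq_le; apply/andP; split.
  by rewrite Qa qc lerD2r qval_le_max.
by rewrite Qb -qc qval_le_max.
Qed.

Lemma bellmanD_ones Q c :
  bellman M (Q + c *: ones) = bellman M Q + (gamma * c) *: ones.
Proof.
rewrite [RHS]addrC -backup_cst; apply/eqP; rewrite -subr_eq bellmanB; apply/eqP.
by congr backup; apply: funext => s; rewrite max_qvalD_ones addrC addKr.
Qed.

Lemma bellman_qstar : bellman M (qstar M) = qstar M.
Proof.
apply: (@getPex _ [set Q | bellman M Q = Q]).
pose F : {fun [set: qvec R S A] >-> [set: qvec R S A]} := [fun of totalfun (bellman M)].
have Fc : is_contraction F.
  exists (NngNum (ltW (discount_gt0 M))); split; first exact: discount_lt1.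
  by move=> [Q Q'] _ /=; exact: bellman_contraction.
have [|//|Q _ FQ] := banach_fixed_point Fc; first exact: closedT.
  by exists 0.
by exists Q; rewrite /= {2}FQ.
Qed.

Section FixedPoint.
Context (Qs : qvec R S A) (Qs_fix : bellman M Qs = Qs).

(** The deflation scalar is chosen so that the error along the all-ones vector
    cancels: with [m = mean (Q - Qs)], the Bellman operator turns [m] into
    [gamma m], and the correction subtracts exactly [gamma m]. *)
Lemma deflated_error Q (delta := bellman M (Qs + proj_perp *m (Q - Qs)) - Qs) :
  deflated_step M Q - Qs = delta + (gamma / (1 - gamma) * mean delta) *: ones.
Proof.
have g1 : 1 - gamma != 0 by rewrite subr_eq0 gt_eqF// discount_lt1.
set m := mean (Q - Qs); set y := proj_perp *m (Q - Qs).
have Qy : Q = Qs + y + m *: ones.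
  by rewrite /y proj_perpE -/m; apply/colP => i; rewrite !mxE; ring.
have FQ : bellman M Q = Qs + delta + (gamma * m) *: ones.
  by rewrite {1}Qy bellmanD_ones /delta -/y [Qs + (_ - _)]addrC addrNK.
have mFQ : mean (bellman M Q - Q) = mean delta + (gamma - 1) * m.
  have -> : bellman M Q - Q = delta + (gamma * m) *: ones - (Q - Qs).
    by rewrite FQ; apply/colP => i; rewrite !mxE; ring.
  by rewrite meanB meanD meanZ mean_ones ?dim_gt0// -/m; ring.
rewrite /deflated_step mFQ FQ; apply/colP => i; rewrite !mxE; field.
exact: g1.
Qed.

Lemma proj_deflated_error Q :
  proj_perp *m (deflated_step M Q - Qs) =
  proj_perp *m (bellman M (Qs + proj_perp *m (Q - Qs)) - bellman M Qs).
Proof.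
rewrite deflated_error Qs_fix mulmxDr -scalemxAr [_ *m ones]proj_perpE.
by rewrite mean_ones ?dim_gt0// scale1r subrr scaler0 addr0.
Qed.

(** The constant comes from [gamma * (1 + gamma / (1 - gamma))], a bound in the
    sup norm, and [sqrt n] converts it to the Euclidean norm. *)
Lemma deflated_error_le Q :
  norm2 (deflated_step M Q - Qs) <=
  Num.sqrt (#|{: S * A}|%:R) * (gamma / (1 - gamma))
  * norm2 (proj_perp *m (Q - Qs)).
Proof.
have g0 := discount_gt0 M; have g1 : 0 < 1 - gamma by rewrite subr_gt0 discount_lt1.
apply: le_trans (norm2_le_norm _) _; rewrite -mulrA ler_wpM2l ?sqrtr_ge0//.
apply: (@le_trans _ _ (gamma / (1 - gamma) * `|proj_perp *m (Q - Qs)|)); last first.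
  by rewrite ler_wpM2l ?norm_le_norm2// divr_ge0 ?ltW.
set delta := bellman M (Qs + proj_perp *m (Q - Qs)) - Qs.
have hd : `|delta| <= gamma * `|proj_perp *m (Q - Qs)|.
  have := bellman_contraction (Qs + proj_perp *m (Q - Qs)) Qs.
  by rewrite Qs_fix -/delta [Qs + _ - Qs in X in _ <= X]addrC addKr.
rewrite deflated_error -/delta; apply: le_trans (ler_normD _ _) _.
rewrite normrZ normr_ones ?dim_gt0// mulr1 normrM ger0_norm; last first.
  by rewrite divr_ge0 ?ltW.
have hm := normr_mean_le dim_gt0 delta.
apply: (@le_trans _ _ (`|delta| / (1 - gamma))); last first.
  by rewrite [leRHS]mulrAC ler_pM2r ?invr_gt0.
have -> : `|delta| / (1 - gamma) = `|delta| + gamma / (1 - gamma) * `|delta|.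
  by field; rewrite gt_eqF.
by rewrite lerD2l ler_wpM2l// divr_ge0 ?ltW.
Qed.

End FixedPoint.

End BellmanTheory.

(** * Deflated iteration in the adapted norm *)

(** A convex function on a box is largest at a vertex.  The coordinates are
    pushed to an endpoint one at a time, so that only segments parallel to the
    axes are ever used. *)
Lemma box_convex_le (R : realType) (S A : finType) (phi : (S -> R) -> R)
    (D : S -> A -> R) (t : R) :
  (forall f g l, 0 <= l <= 1 ->
     phi (fun s => (1 - l) * f s + l * g s) <= (1 - l) * phi f + l * phi g) ->
  (forall pi : {ffun S -> A}, phi (fun s => D s (pi s)) <= t) ->
  forall m, (forall s, exists a b, D s a <= m s <= D s b) -> phi m <= t.
Proof.
move=> cvx vtx m mD.
(* [l] lists the coordinates that may still be interior. *)
suff h (l : seq S) : forall f, (forall s, exists a b, D s a <= f s <= D s b) ->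
    (forall s, s \notin l -> exists a, f s = D s a) -> phi f <= t.
  by apply: (h (enum S)) => // s; rewrite mem_enum.
elim: l => [f _ fD|s0 l IH f fD fl].
  have /choice[pi hpi] : forall s, exists a, f s = D s a by move=> s; exact: fD.
  have -> : f = (fun s => D s ([ffun s => pi s] s)); last exact: vtx.
  by apply: funext => s; rewrite ffunE.
have [a [b /andP[fa fb]]] := fD s0.
pose upd c s := if s == s0 then D s0 c else f s.
have updP c : phi (upd c) <= t.
  apply: IH => s; rewrite /upd; have [->|ss0] := eqVneq s s0.
  - by exists c, c; rewrite lexx.
  - exact: fD.
  - by exists c.
  - by move=> sl; apply: fl; rewrite in_cons negb_or ss0.
have [Dab|Dab] := leP (D s0 b) (D s0 a).
  suff -> : f = upd a by exact: updP.
  apply: funext => s; rewrite /upd; case: eqP => // ->.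
  by apply/le_anti; rewrite fa (le_trans fb).
have Dab0 : 0 < D s0 b - D s0 a by rewrite subr_gt0.
set l0 := (f s0 - D s0 a) / (D s0 b - D s0 a).
have l0P : 0 <= l0 <= 1.
  by rewrite divr_ge0 ?(ltW Dab0) ?subr_ge0//= ler_pdivrMr// mul1r lerD2r.
have -> : f = (fun s => (1 - l0) * upd a s + l0 * upd b s).
  apply: funext => s; rewrite /upd; case: eqP => [->|_]; last by ring.
  by rewrite /l0; field; rewrite gt_eqF.
apply: le_trans (cvx _ _ _ l0P) _; case/andP: l0P => l0_ge0 l0_le1.
have -> : t = (1 - l0) * t + l0 * t by ring.
by rewrite lerD// ler_wpM2l// subr_ge0.
Qed.

Section DeflatedIteration.
Context {R : realType} {S A : finType} (M : mdp R S A).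
Local Notation gamma := (discount M).
Local Notation V := (@ones_perp R #|{: S * A}|).
Local Notation H := (range (proj_policy_mx M)).
Implicit Types (Q y : qvec R S A) (b : R).

Lemma range_policy_neq0 : H !=set0.
Proof. by exists (proj_policy_mx M [ffun=> action0 M]), [ffun=> action0 M]. Qed.

Lemma proj_policy_perp B y : H B -> V y -> V (B *m y).
Proof.
by move=> [pi _ <-] _; rewrite -!mulmxA; apply/ones_perp_proj/(dim_gt0 M).
Qed.

Lemma proj_policy_bounded : exists2 c : R, 0 <= c &
  forall B y, H B -> V y -> norm2 (B *m y) <= c * norm2 y.
Proof.
have /choice[c hc] : forall pi, exists c : R, 0 <= c /\
    forall y, norm2 (proj_policy_mx M pi *m y) <= c * norm2 y.
  move=> pi; have [c c0 hc] := norm2_mulmx_bounded (proj_policy_mx M pi).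
  by exists c.
exists (\sum_pi c pi); first by apply: sumr_ge0 => pi _; case: (hc pi).
move=> _ y [pi _ <-] _; apply: le_trans ((hc pi).2 y) _.
rewrite ler_wpM2r ?norm2_ge0// (bigD1 pi)//= lerDl.
by apply: sumr_ge0 => pi' _; case: (hc pi').
Qed.

Lemma projected_jsr_ge0 : 0 <= projected_jsr M.
Proof.
have [c c0 hc] := proj_policy_bounded.
exact: (jsr_ge0 ones_perp0 ones_perpZ range_policy_neq0 proj_policy_perp c0 hc).
Qed.

(** On the orthogonal complement of the all-ones vector, the projected Bellman
    operator is a [b]-contraction for the adapted norm: by
    [max_qvalB_between] the backed-up values lie in the box whose vertices are
    given by deterministic policies, and the norm is convex. *)
Lemma proj_bellman_adapted b K v Q y : adapted_to V H b K v -> V y ->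
  v (proj_perp *m (bellman M (Q + y) - bellman M Q)) <= b * v y.
Proof.
move=> [_ vD vZ vH] Vy; rewrite bellmanB.
have perp_proj x := ones_perp_proj (dim_gt0 M) x : V _.
apply: (@box_convex_le R S A (fun m => v (proj_perp *m backup M m)) (qval y)).
- move=> f g l /andP[l0 l1]; rewrite backup_linear mulmxDr -!scalemxAr.
  apply: le_trans (vD _ _ _ _) _; try by apply: ones_perpZ.
  by apply: lerD; apply: vZ => //; rewrite subr_ge0.
- move=> pi; rewrite -policy_mx_backup.
  have -> : proj_perp *m (policy_mx M pi *m y) = proj_policy_mx M pi *m y.
    by rewrite /proj_policy_mx -!mulmxA (proj_perp_id Vy).
  by apply: vH => //; exists pi.
- move=> s; have := max_qvalB_between M (Q + y) Q s.
  by rewrite [Q + y - Q]addrC addKr.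
Qed.

(** The exponent is [k - 1] because the last step is spent on bounding the full
    error by the projected error of the previous iterate. *)
Lemma deflated_error_decay b : projected_jsr M < b ->
  exists C : R, 0 < C /\ forall Q : nat -> qvec R S A,
    iterates (deflated_step M) Q -> forall k : nat, (1 <= k)%N ->
    norm2 (Q k - qstar M) <=
      C * b ^+ (k - 1) * norm2 (proj_perp *m (Q 0%N - qstar M)).
Proof.
move=> hb; have b0 : 0 < b := le_lt_trans projected_jsr_ge0 hb.
have [c c0 hc] := proj_policy_bounded.
have [v [K [K0 adv]]] := exists_adapted_norm ones_perp0 (@ones_perpZ _ _)
  range_policy_neq0 proj_policy_perp c0 hc hb.
have [vn _ _ _] := adv; have qfix := bellman_qstar M.
have perp_proj x := ones_perp_proj (dim_gt0 M) x : V _.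
set L := Num.sqrt (#|{: S * A}|%:R) * (gamma / (1 - gamma)).
have L0 : 0 < L.
  rewrite mulr_gt0// ?sqrtr_gt0 ?ltr0n ?(dim_gt0 M)//.
  by rewrite divr_gt0 ?subr_gt0 ?discount_lt1 ?discount_gt0.
exists (L * K); split; first exact: mulr_gt0.
move=> Q itQ [//|k] _; rewrite subn1 /=.
pose u j := proj_perp *m (Q j - qstar M).
have vu j : v (u j) <= b ^+ j * v (u 0%N).
  elim: j => [|j IH]; first by rewrite mul1r.
  rewrite exprS -mulrA; apply: le_trans (ler_wpM2l (ltW b0) IH).
  by rewrite {1}/u itQ (proj_deflated_error qfix) (proj_bellman_adapted _ adv).
rewrite itQ; apply: le_trans (deflated_error_le qfix _) _; rewrite -/L -!(mulrA L).
rewrite ler_pM2l// -mulrA -/(u k) -/(u 0%N).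
have /andP[uk _] := vn _ (perp_proj (Q k - qstar M)).
apply: le_trans uk _; apply: le_trans (vu k) _.
rewrite [leRHS]mulrCA ler_pM2l ?exprn_gt0//.
by have /andP[] := vn _ (perp_proj (Q 0%N - qstar M)).
Qed.

Lemma deflated_error_rate_le (Q : nat -> qvec R S A) :
  iterates (deflated_step M) Q ->
  (error_rate (qstar M) Q <= (projected_jsr M)%:E)%E.
Proof.
(* The [p + 1] below keeps the constant positive when the iteration starts with
   no projected error. *)
move=> itQ; apply/lee_addgt0Pr => e e0.
have he : projected_jsr M < projected_jsr M + e by rewrite ltrDl.
have [C [C0 hC]] := deflated_error_decay he.
have b0 : 0 < projected_jsr M + e by exact: le_lt_trans projected_jsr_ge0 he.
set b := projected_jsr M + e in hC b0; rewrite -EFinD -/b.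
set p := norm2 (proj_perp *m (Q 0%N - qstar M)).
have p0 : 0 <= p by exact: norm2_ge0.
apply: (@limn_esup_root_le _ _ (C * (p + 1) / b)).
- by rewrite divr_gt0// mulr_gt0// ltr_wpDl.
- exact: ltW.
- by move=> k; exact: norm2_ge0.
- move=> [//|k] _; apply: le_trans (hC Q itQ k.+1 isT) _; rewrite subn1/= -/p.
  have -> : C * (p + 1) / b * b ^+ k.+1 = C * b ^+ k * (p + 1).
    by rewrite exprS; field; rewrite gt_eqF.
  by rewrite ler_pM2l ?mulr_gt0 ?exprn_gt0// lerDl.
Qed.

(** The sup-norm contraction bounds every rate by [gamma].  A start at
    [qstar M + ones] attains it, as a constant error is merely scaled by
    [gamma] at each step. *)
Lemma bellman_worst_case_rate :
  worst_case_rate (bellman M) (qstar M) = gamma%:E.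
Proof.
have g0 := discount_gt0 M; have qfix := bellman_qstar M.
have n0 := dim_gt0 M.
apply/eqP; rewrite eq_le; apply/andP; split.
  apply/ereal_supP => _ [Q itQ <-].
  set d := `|Q 0%N - qstar M|.
  have d0 : 0 <= d by exact: normr_ge0.
  have hd k : `|Q k - qstar M| <= gamma ^+ k * d.
    elim: k => [|k IH]; first by rewrite mul1r.
    rewrite itQ -{1}qfix; apply: le_trans (bellman_contraction _ _ _) _.
    by rewrite exprS -mulrA ler_pM2l.
  have s0 : 0 < Num.sqrt (#|{: S * A}|%:R : R) by rewrite sqrtr_gt0 ltr0n.
  apply: (@limn_esup_root_le _ _ (Num.sqrt #|{: S * A}|%:R * (d + 1))).
  - by rewrite mulr_gt0// ltr_wpDl.
  - exact: ltW.
  - by move=> k; exact: norm2_ge0.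
  - move=> k _; apply: le_trans (norm2_le_norm _) _.
    rewrite -mulrA ler_pM2l//; apply: le_trans (hd k) _.
    by rewrite mulrC ler_pM2r ?exprn_gt0// lerDl.
pose Q k := qstar M + gamma ^+ k *: ones.
have itQ : iterates (bellman M) Q.
  by move=> k; rewrite /Q bellmanD_ones qfix exprS.
apply: ereal_sup_ubound; exists Q => //; rewrite /error_rate.
apply: (cvg_limn_einf_sup _).2; apply: cvg_EFin; first by near=> k.
have -> : (fine \o (fun k => (norm2 (Q k - qstar M) `^ k%:R^-1)%:E)) =
    (fun k : nat => (norm2 (ones : qvec R S A) * gamma ^+ k) `^ (k%:R^-1)).
  apply: funext => k /=; congr (_ `^ _).
  by rewrite /Q addrC addKr norm2Z ger0_norm ?exprn_ge0 ?(ltW g0)// mulrC.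
by apply: root_geometric_cvg; [exact: norm2_ones_gt0|exact: ltW].
Unshelve. all: by end_near. Qed.

End DeflatedIteration.

Theorem theorem2 (R : realType) (S A : finType) (M : mdp R S A) :
  [/\ forall eps : R, 0 < eps -> eps < 1 - projected_jsr M ->
        exists C : R, 0 < C /\
          forall Q : nat -> qvec R S A, iterates (deflated_step M) Q ->
          forall k : nat, (1 <= k)%N ->
            norm2 (Q k - qstar M) <=
              C * (projected_jsr M + eps) ^+ (k - 1)
                * norm2 (proj_perp *m (Q 0%N - qstar M)),
      forall Q : nat -> qvec R S A, iterates (deflated_step M) Q ->
        (error_rate (qstar M) Q <= (projected_jsr M)%:E)%E,
      worst_case_rate (bellman M) (qstar M) = (discount M)%:E
    & projected_jsr M < discount M ->
        (exists eps : R, [/\ 0 < eps, eps < 1 - projected_jsr M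
                           & projected_jsr M + eps < discount M]) /\
        (worst_case_rate (deflated_step M) (qstar M) < (discount M)%:E)%E].
Proof.
split.
- by move=> eps eps0 _; apply: deflated_error_decay; rewrite ltrDl.
- exact: deflated_error_rate_le.
- exact: bellman_worst_case_rate.
- move=> hj; have g1 := discount_lt1 M; split.
    by exists ((discount M - projected_jsr M) / 2); split; lra.
  apply: le_lt_trans (_ : (_ <= (projected_jsr M)%:E)%E) _; last by rewrite lte_fin.
  by apply/ereal_supP => _ [Q itQ <-]; exact: deflated_error_rate_le.
Qed.
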